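(* Let $W$ be a regular Bessel type matrix weight that admits a factorization $W(z)=W_{\mathsf L}(z)W_{\mathsf R}(z)$, where $z^2W_{\mathsf L}'(z)=h^{\mathsf L}(z)W_{\mathsf L}(z)$ and $z^2W_{\mathsf R}'(z)=W_{\mathsf R}(z)h^{\mathsf R}(z)$ with entire matrix functions $h^{\mathsf L},h^{\mathsf R}$. Then, for all $n\in\mathbb N$, $$z^2\big(Y_n^{\mathsf L}\big)'(z)+Y_n^{\mathsf L}(z)\begin{bmatrix}h^{\mathsf L}(z)&0\\0&-h^{\mathsf R}(z)\end{bmatrix}=\widetilde M_n^{\mathsf L}(z)\,Y_n^{\mathsf L}(z),$$ $$z^2\big(Y_n^{\mathsf R}\big)'(z)+\begin{bmatrix}h^{\mathsf R}(z)&0\\0&-h^{\mathsf L}(z)\end{bmatrix}Y_n^{\mathsf R}(z)=Y_n^{\mathsf R}(z)\,\widetilde M_n^{\mathsf R}(z).$$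
   Context: $\mathbb N=\{0,1,2,\dots\}$; $N\ge1$ is fixed; $I$ and $0$ denote identity and zero matrices; block matrices have $N\times N$ blocks. Curve: $\gamma$ is a simple loop starting at the origin, encircling the point at infinity once in the positive direction, and then returning to the origin; $(f)_\pm$ are boundary values on $\gamma$ from the two sides determined by its orientation. Bessel type: an $N\times N$ matrix of weights $W=[W^{(j,k)}]$ with support $\gamma$ is of Bessel type if $W^{(j,k)}(z)=\sum_{m\in I_{j,k}}\varphi_m(z)z^{p_m}\log^{q_m}(z)\,e^{-\lambda_m/z}$, $z\in\gamma$, with finite index sets $I_{j,k}$, exponents $p_m$, $\Re(\lambda_m)\ge0$, $q_m\in\mathbb N$, and $\varphi_m$ Hölder continuous, bounded and nonvanishing on $\gamma$, having a holomorphic extension to $\mathbb C$. Regular: the moments $W_n=\int_\gamma z^nW(z)\frac{dz}{2\pi i}$ exist and $\det[W_{j+k}]_{j,k=0,\dots,n}\ne0$ for all $n\in\mathbb N$. Factorization: $W_{\mathsf L},W_{\mathsf R}$ are invertible matrix solutions of the stated differential equations, holomorphic on $\mathbb C\setminus\gamma$, possibly with a branch point at $0$, so that there are constant matrices $\mathsf C^{\mathsf L},\mathsf C^{\mathsf R}$ with $(W_{\mathsf L})_-=(W_{\mathsf L})_+\mathsf C^{\mathsf L}$, $(W_{\mathsf R})_-=\mathsf C^{\mathsf R}(W_{\mathsf R})_+$ on $\gamma$. Biorthogonal polynomials: $P_n^{\mathsf L},P_n^{\mathsf R}$ are the monic $N\times N$ matrix polynomials of degree $n$ with $\int_\gamma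 P_n^{\mathsf L}(z)W(z)z^k\frac{dz}{2\pi i}=\delta_{n,k}C_n^{-1}$ and $\int_\gamma z^kW(z)P_n^{\mathsf R}(z)\frac{dz}{2\pi i}=\delta_{n,k}C_n^{-1}$ for $k\in\{0,\dots,n\}$, with $C_n$ nonsingular. Second kind functions: $Q_n^{\mathsf L}(z)=\int_\gamma\frac{P_n^{\mathsf L}(z')}{z'-z}W(z')\frac{dz'}{2\pi i}$, $Q_n^{\mathsf R}(z)=\int_\gamma W(z')\frac{P_n^{\mathsf R}(z')}{z'-z}\frac{dz'}{2\pi i}$. Conventions: $P_{-1}^{\mathsf L}=P_{-1}^{\mathsf R}=0$, $Q_{-1}^{\mathsf L}=Q_{-1}^{\mathsf R}=-C_{-1}^{-1}$ (so $-C_{-1}Q^{\mathsf L}_{-1}=-Q^{\mathsf R}_{-1}C_{-1}=I$). Put $$Y_n^{\mathsf L}=\begin{bmatrix}P_n^{\mathsf L}&Q_n^{\mathsf L}\\-C_{n-1}P_{n-1}^{\mathsf L}&-C_{n-1}Q_{n-1}^{\mathsf L}\end{bmatrix},\qquad Y_n^{\mathsf R}=\begin{bmatrix}P_n^{\mathsf R}&-P_{n-1}^{\mathsf R}C_{n-1}\\Q_n^{\mathsf R}&-Q_{n-1}^{\mathsf R}C_{n-1}\end{bmatrix},$$ $$Z_n^{\mathsf L}=Y_n^{\mathsf L}\begin{bmatrix}W_{\mathsf L}&0\\0&W_{\mathsf R}^{-1}\end{bmatrix},\qquad Z_n^{\mathsf R}=\begin{bmatrix}W_{\mathsf R}&0\\0&W_{\mathsf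 L}^{-1}\end{bmatrix}Y_n^{\mathsf R}.$$ Structure matrices: $M_n^{\mathsf L}=(Z_n^{\mathsf L})'(Z_n^{\mathsf L})^{-1}$, $M_n^{\mathsf R}=(Z_n^{\mathsf R})^{-1}(Z_n^{\mathsf R})'$, and $\widetilde M_n^{\mathsf L}(z)=z^2M_n^{\mathsf L}(z)$, $\widetilde M_n^{\mathsf R}(z)=z^2M_n^{\mathsf R}(z)$. *)

(* Defs.v *)
From HB Require Import structures.
From mathcomp Require Import all_boot all_order all_algebra complex.
From mathcomp Require Import all_classical all_reals all_analysis.

Set Implicit Arguments.
Unset Strict Implicit.
Unset Printing Implicit Defensive.

Import Order.TTheory GRing.Theory Num.Theory numFieldNormedType.Exports.

Local Open Scope classical_set_scope.
Local Open Scope ring_scope.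

(** [R[i]] as a [numClosedFieldType]. The constant lets type inference equip it,
    and matrices over it, with the topology of a numeric field: [derivable f z 1]
    and [derive1 f z] are then complex differentiability and the complex
    derivative. *)
Definition Cplx (R : realType) : numClosedFieldType := R[i].

Definition entire (R : realType) (V : normedModType (Cplx R))
    (f : Cplx R -> V) : Prop :=
  forall z, derivable f z 1.

(** The norm [`|z|] lives in [Cplx R]; this is its value in [R]. *)
Definition cabs (R : realType) (z : Cplx R) : R := complex.Re `|z|.

Definition cexp (R : realType) (z : Cplx R) : Cplx R :=
  Complex (expR (complex.Re z) * cos (complex.Im z))
          (expR (complex.Re z) * sin (complex.Im z)).

Definition twopii (R : realType) : Cplx R := Complex 0 (2 * pi).

(** * Contours, parametrised by [[0, 1]] *)

Definition loop_trace (R : realType) (gamma : R -> Cplx R) : set (Cplx R) :=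
  gamma @` `[0, 1].

Definition velocity (R : realType) (gamma : R -> Cplx R) (t : R) : Cplx R :=
  Complex (derive1 (fun s : R => complex.Re (gamma s)) t)
          (derive1 (fun s : R => complex.Im (gamma s)) t).

(** Absolute (Lebesgue) integrability of [f(z) dz] along the contour. *)
Definition contour_integrable (R : realType) (gamma : R -> Cplx R)
    (f : Cplx R -> Cplx R) : Prop :=
  lebesgue_measure.-integrable `[0, 1]
    (EFin \o (fun t : R => complex.Re (f (gamma t) * velocity gamma t))) /\
  lebesgue_measure.-integrable `[0, 1]
    (EFin \o (fun t : R => complex.Im (f (gamma t) * velocity gamma t))).

Definition contour_int (R : realType) (gamma : R -> Cplx R)
    (f : Cplx R -> Cplx R) : Cplx R :=
  Complex
    (\int[lebesgue_measure]_(t in `[0, 1])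
        complex.Re (f (gamma t) * velocity gamma t))
    (\int[lebesgue_measure]_(t in `[0, 1])
        complex.Im (f (gamma t) * velocity gamma t)).

(** Entrywise integral of a matrix function against [dz / (2 pi i)]. *)
Definition mx_contour_int (R : realType) (m n : nat) (gamma : R -> Cplx R)
    (F : Cplx R -> 'M[Cplx R]_(m, n)) : 'M[Cplx R]_(m, n) :=
  \matrix_(i, j) ((twopii R)^-1 * contour_int gamma (fun z => F z i j)).

Definition winding (R : realType) (gamma : R -> Cplx R) (z : Cplx R) : Cplx R :=
  (twopii R)^-1 * contour_int gamma (fun w => (w - z)^-1).

(** A rectifiable simple loop based at the origin, in a Lipschitz parametrisation
    (so that [velocity] exists almost everywhere). In the coordinate
    [u = 1 / (z - z0)] the point at infinity is [u = 0], and the winding number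
    of the image loop around [u = 0] is [- winding gamma z0]; it must be [+1] for
    [z0] enclosed by the loop. *)
Definition loop_around_infinity (R : realType) (gamma : R -> Cplx R) : Prop :=
  [/\ gamma 0 = 0 /\ gamma 1 = 0,
      {in `[0, 1[ &, injective gamma},
      exists K : R, {in `[0, 1] &, forall s t : R,
        cabs (gamma s - gamma t) <= K * `|s - t|} &
      exists2 z0 : Cplx R, ~ loop_trace gamma z0 & winding gamma z0 = -1].

(** The side on the left (+) of the oriented loop has the larger winding number.
    As the loop has infinity on its left, the winding number is 0 on the + side
    and -1 on the - side. *)
Definition plus_side (R : realType) (gamma : R -> Cplx R) : set (Cplx R) :=
  [set z | ~ loop_trace gamma z /\ winding gamma z = 0].

Definition minus_side (R : realType) (gamma : R -> Cplx R) : set (Cplx R) :=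
  [set z | ~ loop_trace gamma z /\ winding gamma z = -1].

Definition boundary_value (R : realType) (N : nat) (side : set (Cplx R))
    (F : Cplx R -> 'M[Cplx R]_N.+1) (z : Cplx R) (A : 'M[Cplx R]_N.+1) : Prop :=
  F @ within side (nbhs z) --> A.

(** * Bessel type weights *)

Definition bessel_coefficient (R : realType) (gamma : R -> Cplx R)
    (phi : Cplx R -> Cplx R) : Prop :=
  [/\ exists alpha K : R, [/\ 0 < alpha, alpha <= 1 &
        forall z w, loop_trace gamma z -> loop_trace gamma w ->
          cabs (phi z - phi w) <= K * cabs (z - w) `^ alpha],
      exists B : R, forall z, loop_trace gamma z -> cabs (phi z) <= B,
      forall z, loop_trace gamma z -> phi z != 0 &
      exists2 Phi : Cplx R -> Cplx R, entire Phi &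
        forall z, loop_trace gamma z -> Phi z = phi z].

(** [ell t] is a continuous branch of [log (gamma t)] along the open loop, so
    [cexp (p * ell t)] is [z ^ p] at [z = gamma t]. Another branch replaces [ell]
    by [ell + 2 pi i k], which does not change the class of weights. The value of
    a weight at the origin is irrelevant. *)
Definition bessel_type (R : realType) (N : nat) (gamma : R -> Cplx R)
    (W : Cplx R -> 'M[Cplx R]_N.+1) : Prop :=
  exists ell : R -> Cplx R,
    [/\ {in `]0, 1[, continuous ell},
        {in `]0, 1[, forall t, cexp (ell t) = gamma t} &
        forall j k : 'I_N.+1,
        exists (I : finType) (phi : I -> Cplx R -> Cplx R)
               (p : I -> Cplx R) (q : I -> nat) (lambda : I -> Cplx R),
          [/\ forall m, bessel_coefficient gamma (phi m),
              forall m, 0 <= complex.Re (lambda m) &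
              {in `]0, 1[, forall t, W (gamma t) j k =
                 \sum_(m : I) phi m (gamma t) * cexp (p m * ell t)
                              * ell t ^+ q m * cexp (- lambda m / gamma t)}]].

Definition moment (R : realType) (N : nat) (gamma : R -> Cplx R)
    (W : Cplx R -> 'M[Cplx R]_N.+1) (n : nat) : 'M[Cplx R]_N.+1 :=
  mx_contour_int gamma (fun z => z ^+ n *: W z).

Definition regular (R : realType) (N : nat) (gamma : R -> Cplx R)
    (W : Cplx R -> 'M[Cplx R]_N.+1) : Prop :=
  (forall (n : nat) (i j : 'I_N.+1),
     contour_integrable gamma (fun z => z ^+ n * W z i j)) /\
  (forall n : nat,
     \det (\mxblock_(j < n.+1, k < n.+1) moment gamma W (j + k)%N) != 0).

(** On the loop, the product [W_L W_R] is that of the + boundary values. *)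
Definition bessel_factorization (R : realType) (N : nat) (gamma : R -> Cplx R)
    (W WL WR hL hR : Cplx R -> 'M[Cplx R]_N.+1) : Prop :=
  [/\ entire hL /\ entire hR,
      forall z, ~ loop_trace gamma z ->
        [/\ derivable WL z 1, derivable WR z 1,
            WL z \in unitmx & WR z \in unitmx],
      forall z, ~ loop_trace gamma z ->
        z ^+ 2 *: derive1 WL z = hL z *m WL z /\
        z ^+ 2 *: derive1 WR z = WR z *m hR z &
      exists CL CR : 'M[Cplx R]_N.+1,
        forall z, loop_trace gamma z -> z != 0 ->
        exists WLp WLm WRp WRm : 'M[Cplx R]_N.+1,
          [/\ boundary_value (plus_side gamma) WL z WLp /\
              boundary_value (minus_side gamma) WL z WLm,
              boundary_value (plus_side gamma) WR z WRp /\
              boundary_value (minus_side gamma) WR z WRm,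
              WLm = WLp *m CL, WRm = CR *m WRp &
              W z = WLp *m WRp]].

(** * Biorthogonal polynomials and functions of the second kind *)

Definition mxpoly_eval (R : realType) (N : nat) (P : {poly 'M[Cplx R]_N.+1})
    (z : Cplx R) : 'M[Cplx R]_N.+1 :=
  P.[z%:M].

Definition biorthogonal (R : realType) (N : nat) (gamma : R -> Cplx R)
    (W : Cplx R -> 'M[Cplx R]_N.+1) (PL PR : nat -> {poly 'M[Cplx R]_N.+1})
    (C : nat -> 'M[Cplx R]_N.+1) : Prop :=
  forall n : nat,
    [/\ PL n \is monic /\ size (PL n) = n.+1,
        PR n \is monic /\ size (PR n) = n.+1,
        C n \in unitmx,
        forall k : nat, (k <= n)%N ->
          mx_contour_int gamma
            (fun z => z ^+ k *: (mxpoly_eval (PL n) z *m W z))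
          = (n == k)%:R *: invmx (C n) &
        forall k : nat, (k <= n)%N ->
          mx_contour_int gamma
            (fun z => z ^+ k *: (W z *m mxpoly_eval (PR n) z))
          = (n == k)%:R *: invmx (C n)].

Definition QL (R : realType) (N : nat) (gamma : R -> Cplx R)
    (W : Cplx R -> 'M[Cplx R]_N.+1) (PL : nat -> {poly 'M[Cplx R]_N.+1})
    (n : nat) (z : Cplx R) : 'M[Cplx R]_N.+1 :=
  mx_contour_int gamma (fun w => (w - z)^-1 *: (mxpoly_eval (PL n) w *m W w)).

Definition QR (R : realType) (N : nat) (gamma : R -> Cplx R)
    (W : Cplx R -> 'M[Cplx R]_N.+1) (PR : nat -> {poly 'M[Cplx R]_N.+1})
    (n : nat) (z : Cplx R) : 'M[Cplx R]_N.+1 :=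
  mx_contour_int gamma (fun w => (w - z)^-1 *: (W w *m mxpoly_eval (PR n) w)).

(** For [n = 0] the entries built from the index -1 are given by the conventions
    [P_(-1) = 0] and [- C_(-1) Q^L_(-1) = - Q^R_(-1) C_(-1) = I]. *)
Definition YL (R : realType) (N : nat) (gamma : R -> Cplx R)
    (W : Cplx R -> 'M[Cplx R]_N.+1) (PL : nat -> {poly 'M[Cplx R]_N.+1})
    (C : nat -> 'M[Cplx R]_N.+1) (n : nat) (z : Cplx R) :
    'M[Cplx R]_(N.+1 + N.+1) :=
  match n with
  | 0%N => block_mx (mxpoly_eval (PL 0%N) z) (QL gamma W PL 0 z)
                    0                        1%:M
  | m.+1 => block_mx (mxpoly_eval (PL m.+1) z)      (QL gamma W PL m.+1 z)
                     (- C m *m mxpoly_eval (PL m) z) (- C m *m QL gamma W PL m z)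
  end.

Definition YR (R : realType) (N : nat) (gamma : R -> Cplx R)
    (W : Cplx R -> 'M[Cplx R]_N.+1) (PR : nat -> {poly 'M[Cplx R]_N.+1})
    (C : nat -> 'M[Cplx R]_N.+1) (n : nat) (z : Cplx R) :
    'M[Cplx R]_(N.+1 + N.+1) :=
  match n with
  | 0%N => block_mx (mxpoly_eval (PR 0%N) z) 0
                    (QR gamma W PR 0 z)      1%:M
  | m.+1 => block_mx (mxpoly_eval (PR m.+1) z) (- mxpoly_eval (PR m) z *m C m)
                     (QR gamma W PR m.+1 z)    (- QR gamma W PR m z *m C m)
  end.

Definition ZL (R : realType) (N : nat) (gamma : R -> Cplx R)
    (W WL WR : Cplx R -> 'M[Cplx R]_N.+1)
    (PL : nat -> {poly 'M[Cplx R]_N.+1}) (C : nat -> 'M[Cplx R]_N.+1)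
    (n : nat) (z : Cplx R) : 'M[Cplx R]_(N.+1 + N.+1) :=
  YL gamma W PL C n z *m block_mx (WL z) 0 0 (invmx (WR z)).

Definition ZR (R : realType) (N : nat) (gamma : R -> Cplx R)
    (W WL WR : Cplx R -> 'M[Cplx R]_N.+1)
    (PR : nat -> {poly 'M[Cplx R]_N.+1}) (C : nat -> 'M[Cplx R]_N.+1)
    (n : nat) (z : Cplx R) : 'M[Cplx R]_(N.+1 + N.+1) :=
  block_mx (WR z) 0 0 (invmx (WL z)) *m YR gamma W PR C n z.

(** * Structure matrices *)

Definition ML (R : realType) (N : nat) (gamma : R -> Cplx R)
    (W WL WR : Cplx R -> 'M[Cplx R]_N.+1)
    (PL : nat -> {poly 'M[Cplx R]_N.+1}) (C : nat -> 'M[Cplx R]_N.+1)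
    (n : nat) (z : Cplx R) : 'M[Cplx R]_(N.+1 + N.+1) :=
  derive1 (ZL gamma W WL WR PL C n) z *m invmx (ZL gamma W WL WR PL C n z).

Definition MR (R : realType) (N : nat) (gamma : R -> Cplx R)
    (W WL WR : Cplx R -> 'M[Cplx R]_N.+1)
    (PR : nat -> {poly 'M[Cplx R]_N.+1}) (C : nat -> 'M[Cplx R]_N.+1)
    (n : nat) (z : Cplx R) : 'M[Cplx R]_(N.+1 + N.+1) :=
  invmx (ZR gamma W WL WR PR C n z) *m derive1 (ZR gamma W WL WR PR C n) z.

Definition tML (R : realType) (N : nat) (gamma : R -> Cplx R)
    (W WL WR : Cplx R -> 'M[Cplx R]_N.+1)
    (PL : nat -> {poly 'M[Cplx R]_N.+1}) (C : nat -> 'M[Cplx R]_N.+1)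
    (n : nat) (z : Cplx R) : 'M[Cplx R]_(N.+1 + N.+1) :=
  z ^+ 2 *: ML gamma W WL WR PL C n z.

Definition tMR (R : realType) (N : nat) (gamma : R -> Cplx R)
    (W WL WR : Cplx R -> 'M[Cplx R]_N.+1)
    (PR : nat -> {poly 'M[Cplx R]_N.+1}) (C : nat -> 'M[Cplx R]_N.+1)
    (n : nat) (z : Cplx R) : 'M[Cplx R]_(N.+1 + N.+1) :=
  z ^+ 2 *: MR gamma W WL WR PR C n z.

(* Main.v *)
(** The matrix [Y_n^L] is inverse to [Y_n^R] up to conjugation by [[0, 1], [-1, 0]].
    This needs no uniqueness argument for a Riemann-Hilbert problem: writing
    [P(z) = P(w) - (w - z) D(w)] with [D] the divided difference of [P] cancels the
    Cauchy kernel in [Q_n^L(z) P_m^R(z) - P_n^L(z) Q_m^R(z)], and biorthogonality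
    then evaluates what remains as a constant. Off the contour the Cauchy integrals
    [Q_n] are differentiable, because the difference quotient of the resolvent
    [1 / (w - z)] converges uniformly for [w] on the compact contour. The structure
    equations are then the product rule for [Z_n]. *)
Require Import Defs.
From HB Require Import structures.
From mathcomp Require Import all_boot all_order all_algebra complex.
From mathcomp Require Import all_classical all_reals all_analysis.
From mathcomp Require Import perm zify ring lra measurable_realfun.

Set Implicit Arguments.
Unset Strict Implicit.
Unset Printing Implicit Defensive.

Import Order.TTheory GRing.Theory Num.Theory numFieldNormedType.Exports.

Local Open Scope classical_set_scope.
Local Open Scope ring_scope.

(** * Derivatives of matrix functions *)

(** Invertibility is the crux: [invmx] returns a singular matrix unchanged, so [M_n] is a
    logarithmic derivative only where [Z_n] is a unit. The blocks of [Y_n] do not commute, so its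
    determinant is not read off from them; an explicit inverse is exhibited instead. For indices
    [n], [m] at distance at most one, the constant of the bilinear identity is the coefficient of
    order [m+1] of [P_n^L] times [C_m^-1], minus [C_n^-1] times the coefficient of order [n+1] of
    [P_m^R]. For equal indices it is 0, for neighbouring ones it is plus or minus the inverse of one
    [C], and these values are exactly the blocks of the identity matrix. On the analytic side, [W]
    is integrable along the loop but no bound on it is assumed. Every integrand is therefore a
    factor continuous on the loop times a fixed integrable one, and a single estimate, supremum
    times L1 norm, controls the limits. *)

Lemma cvg_mxP (T : topologicalType) (m n : nat) (I : Type)
    (F : set_system I) (FF : Filter F) (f : I -> 'M[T]_(m, n)) (M : 'M[T]_(m, n)) :
  f @ F --> M <-> forall i j, (fun x => f x i j) @ F --> M i j.
Proof.
split=> [fM i j A nA|fM A [P nP PA]].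
- apply: (fM [set N | A (N i j)]).
  exists (fun i' j' => if (i' == i) && (j' == j) then A else setT).
    by move=> i' j'; case: ifP => [/andP[/eqP -> /eqP ->]//|_]; exact: filterT.
  by move=> N /(_ i j); rewrite !eqxx.
(* There are finitely many entries, so the entrywise conditions hold simultaneously along [F]. *)
- have H : \forall x \near F, forall ij : 'I_m * 'I_n, P ij.1 ij.2 (f x ij.1 ij.2).
    by apply: filter_forall => -[i j] /=; exact: fM.
  by apply: filterS H => x H; apply: PA => i j; exact: (H (i, j)).
Qed.

Section MatrixDerivative.
Context {K : numFieldType}.

Lemma is_derive_cvgP (V : normedModType K) (f : K -> V) (z : K) (D : V) :
  is_derive z 1 f D <->
  (fun h => h^-1 *: (f (h + z) - f z)) @ 0^' --> D.
Proof.
have -> : (fun h => h^-1 *: (f (h + z) - f z)) =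
          (fun h => h^-1 *: ((f \o shift z) (h *: 1) - f z)).
  by apply/funext => h /=; rewrite [h%:A]mulr1.
split=> [[df <-]//|fD]; split; first by apply/cvg_ex; exists D.
exact: (cvg_lim (@norm_hausdorff _ V) fD).
Qed.

Lemma is_derive_mxP (m n : nat) (F : K -> 'M[K]_(m, n)) (z : K) D :
  is_derive z 1 F D <-> forall i j, is_derive z 1 (fun x => F x i j) (D i j).
Proof.
rewrite is_derive_cvgP cvg_mxP.
have E i j : (fun h => (h^-1 *: (F (h + z) - F z)) i j) =
    (fun h => h^-1 *: (F (h + z) i j - F z i j)).
  by apply/funext => h; rewrite !mxE.
by split=> H i j; [apply/is_derive_cvgP; rewrite -E | rewrite E; apply/is_derive_cvgP].
Qed.

Lemma is_derive_mulmx (m n p : nat) (F : K -> 'M[K]_(m, n)) (G : K -> 'M[K]_(n, p))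
    (z : K) (F' : 'M[K]_(m, n)) (G' : 'M[K]_(n, p)) :
  is_derive z 1 F F' -> is_derive z 1 G G' ->
  is_derive z 1 (fun x => F x *m G x) (F' *m G z + F z *m G').
Proof.
move=> /is_derive_mxP dF /is_derive_mxP dG; apply/is_derive_mxP => i j.
have -> : (fun x => (F x *m G x) i j) =
    \sum_(k < n) ((fun x => F x i k) * (fun x => G x k j)).
  by apply/funext => x; rewrite mxE fct_sumE.
apply: (@is_derive_eq _ _ _ _ _ _ _ _ (is_derive_sum (fun k => is_deriveM (dF i k) (dG k j)))).
rewrite !mxE -big_split/=; apply: eq_bigr => k _.
by rewrite addrC [G z k j *: _]mulrC.
Qed.

Lemma is_derive_block_mx (m1 m2 n1 n2 : nat)
    (A : K -> 'M[K]_(m1, n1)) (B : K -> 'M[K]_(m1, n2))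
    (C : K -> 'M[K]_(m2, n1)) (D : K -> 'M[K]_(m2, n2)) (z : K) A' B' C' D' :
  is_derive z 1 A A' -> is_derive z 1 B B' ->
  is_derive z 1 C C' -> is_derive z 1 D D' ->
  is_derive z 1 (fun x => block_mx (A x) (B x) (C x) (D x)) (block_mx A' B' C' D').
Proof.
move=> /is_derive_mxP dA /is_derive_mxP dB /is_derive_mxP dC /is_derive_mxP dD.
apply/is_derive_mxP => i j; rewrite -(fintype.splitK i) -(fintype.splitK j).
by case: (fintype.split i) => i'; case: (fintype.split j) => j' /=;
  rewrite ?(block_mxEul, block_mxEur, block_mxEdl, block_mxEdr);
  under eq_fun do rewrite ?(block_mxEul, block_mxEur, block_mxEdl, block_mxEdr).
Qed.

Lemma derivable_mulmx (m n p : nat) (F : K -> 'M[K]_(m, n)) (G : K -> 'M[K]_(n, p))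
    (z : K) :
  derivable F z 1 -> derivable G z 1 -> derivable (fun x => F x *m G x) z 1.
Proof.
by move=> /derivableP dF /derivableP dG; case: (is_derive_mulmx dF dG).
Qed.

Lemma derivable_oppmx (m n : nat) (F : K -> 'M[K]_(m, n)) (z : K) :
  derivable F z 1 -> derivable (fun x => - F x) z 1.
Proof. exact: derivableN. Qed.

Lemma derivable_block_mx (m1 m2 n1 n2 : nat)
    (A : K -> 'M[K]_(m1, n1)) (B : K -> 'M[K]_(m1, n2))
    (C : K -> 'M[K]_(m2, n1)) (D : K -> 'M[K]_(m2, n2)) (z : K) :
  derivable A z 1 -> derivable B z 1 -> derivable C z 1 -> derivable D z 1 ->
  derivable (fun x => block_mx (A x) (B x) (C x) (D x)) z 1.
Proof.
move=> /derivableP dA /derivableP dB /derivableP dC /derivableP dD.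
by case: (is_derive_block_mx dA dB dC dD).
Qed.

Lemma derivable_bigsum (I : Type) (r : seq I) (f : I -> K -> K) (z : K) :
  (forall i, derivable (f i) z 1) -> derivable (fun x => \sum_(i <- r) f i x) z 1.
Proof.
move=> df; have -> : (fun x => \sum_(i <- r) f i x) = \sum_(i <- r) f i.
  by apply/funext => x; rewrite fct_sumE.
by elim/big_ind : _ => [|f1 f2|i _ //]; [exact: derivable_cst|exact: derivableD].
Qed.

Lemma derivable_bigprod (I : Type) (r : seq I) (f : I -> K -> K) (z : K) :
  (forall i, derivable (f i) z 1) -> derivable (fun x => \prod_(i <- r) f i x) z 1.
Proof.
move=> df; have -> : (fun x => \prod_(i <- r) f i x) = \prod_(i <- r) f i.
  by apply/funext => x; rewrite fct_prodE.
by elim/big_ind : _ => [|f1 f2|i _ //]; [exact: derivable_cst|exact: derivableM].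
Qed.

Lemma derivable_mull (c : K) (f : K -> K) (z : K) :
  derivable f z 1 -> derivable (fun x => c * f x) z 1.
Proof.
move=> df; apply: (@derivableM K K (cst c) f); last exact: df.
exact: derivable_cst.
Qed.

Lemma derivable_monomial (n : nat) (c z : K) : derivable (fun x : K => x ^+ n * c) z 1.
Proof.
apply: (@derivableM K K (fun x : K => x ^+ n) (cst c)); last exact: derivable_cst.
have -> : (fun x : K => x ^+ n) = (id : K -> K) ^+ n by apply/funext => x; rewrite exprfctE.
by apply: derivableX; exact: derivable_id.
Qed.

Lemma derivable_det (n : nat) (F : K -> 'M[K]_n) (z : K) :
  (forall i j, derivable (fun x => F x i j) z 1) -> derivable (fun x => \det (F x)) z 1.
Proof.
move=> dF; rewrite /determinant; apply: derivable_bigsum => s.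
apply: (@derivableM K K (cst ((-1) ^+ s)) (fun x => \prod_i F x i (s i))).
  exact: derivable_cst.
by apply: derivable_bigprod => i; exact: dF.
Qed.

(** Cramer's rule: near [z] the inverse is the adjugate over the determinant, both polynomial in the
    entries. Invertibility near [z] matters because [invmx] follows this formula only on units. *)
Lemma derivable_invmx (n : nat) (F : K -> 'M[K]_n) (z : K) :
  derivable F z 1 -> (\forall x \near z, F x \in unitmx) ->
  derivable (fun x => invmx (F x)) z 1.
Proof.
move=> /derivableP/is_derive_mxP dF uF.
have dFij i j : derivable (fun x => F x i j) z 1 by case: (dF i j).
have uz : F z \in unitmx by exact: nbhs_singleton uF.
pose G x : 'M[K]_n := (\det (F x))^-1 *: \adj (F x).
have dG : is_derive z 1 G (\matrix_(i, j) 'D_1 (fun x => G x i j) z).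
  apply/is_derive_mxP => i j; rewrite mxE; apply: derivableP.
  have -> : (fun x => G x i j) =
      (fun x => (\det (F x))^-1) * (fun x => cofactor (F x) j i).
    by apply/funext => x; rewrite /G !mxE.
  apply: derivableM.
    apply: derivableV; last exact: derivable_det.
    by move: uz; rewrite unitmxE unitfE.
  apply: (@derivableM K K (cst ((-1) ^+ (j + i)))
    (fun x => \det (row' j (col' i (F x))))); first exact: derivable_cst.
  apply: derivable_det => k l.
  have -> : (fun x => row' j (col' i (F x)) k l) = (fun x => F x (lift j k) (lift i l)).
    by apply/funext => x; rewrite !mxE.
  exact: dFij.
have [d _] := dG.
apply: near_eq_derivable d.
near=> x; rewrite /G /invmx; have -> // : F x \in unitmx by near: x.
Unshelve. all: by end_near. Qed.

(** Differentiability being known, the value comes from differentiating [F x *m invmx (F x)], which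
    is constantly the identity near [z]. *)
Lemma is_derive_invmx (n : nat) (F : K -> 'M[K]_n) (z : K) (F' : 'M[K]_n) :
  is_derive z 1 F F' -> (\forall x \near z, F x \in unitmx) ->
  is_derive z 1 (fun x => invmx (F x)) (- (invmx (F z) *m F' *m invmx (F z))).
Proof.
move=> dF uF; have [dF1 _] := dF.
have uz : F z \in unitmx by exact: nbhs_singleton uF.
have dI := derivableP (derivable_invmx dF1 uF).
have dP := is_derive_mulmx dF dI.
suff E : F' *m invmx (F z) + F z *m 'D_1 (fun x => invmx (F x)) z = 0.
  apply: is_derive_eq.
  move/eqP: E; rewrite addrC addr_eq0 => /eqP /(congr1 (mulmx (invmx (F z)))).
  by rewrite mulKmx// mulmxN mulmxA.
have [_ <-] := dP.
rewrite -[RHS](derive_cst (1%:M : 'M[K]_n) z 1).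
apply: near_eq_derive.
by near=> x; rewrite mulmxV//; near: x.
Unshelve. all: by end_near. Qed.

End MatrixDerivative.

(** * Contour integrals *)

Section ComplexNumbers.
Context {R : realType}.
Implicit Types x y : Cplx R.

Lemma cplxP x y : complex.Re x = complex.Re y -> complex.Im x = complex.Im y -> x = y.
Proof. by case: x y => a b [c d] /= -> ->. Qed.

Lemma cReD x y : complex.Re (x + y) = complex.Re x + complex.Re y.
Proof. by case: x y => a b [c d]. Qed.

Lemma cImD x y : complex.Im (x + y) = complex.Im x + complex.Im y.
Proof. by case: x y => a b [c d]. Qed.

Lemma cReB x y : complex.Re (x - y) = complex.Re x - complex.Re y.
Proof. by case: x y => a b [c d]. Qed.

Lemma cImB x y : complex.Im (x - y) = complex.Im x - complex.Im y.
Proof. by case: x y => a b [c d]. Qed.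

Lemma cReM x y :
  complex.Re (x * y) = complex.Re x * complex.Re y - complex.Im x * complex.Im y.
Proof. by case: x y => a b [c d]. Qed.

Lemma cImM x y :
  complex.Im (x * y) = complex.Re x * complex.Im y + complex.Im x * complex.Re y.
Proof. by case: x y => a b [c d]. Qed.

Lemma cabsE x : `|x| = (cabs x)%:C%C.
Proof. by rewrite /cabs normc_def. Qed.

Lemma cabs_ge0 x : 0 <= cabs x.
Proof. by rewrite -lecR -cabsE normr_ge0. Qed.

Lemma cabsM x y : cabs (x * y) = cabs x * cabs y.
Proof. by apply: (@complexI R); rewrite rmorphM/= -!cabsE normrM. Qed.

Lemma cabsV x : cabs x^-1 = (cabs x)^-1.
Proof. by apply: (@complexI R); rewrite fmorphV/= -!cabsE normfV. Qed.

Lemma cabs_gt0 x : (0 < cabs x) = (x != 0).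
Proof. by rewrite -ltcR -cabsE normr_gt0. Qed.

Lemma ler_cabsD x y : cabs (x + y) <= cabs x + cabs y.
Proof. by rewrite -lecR rmorphD/= -!cabsE ler_normD. Qed.

Lemma ler_norm_Re x : `|complex.Re x| <= cabs x.
Proof. by rewrite -lecR -cabsE normc_ge_Re. Qed.

Lemma ler_norm_Im x : `|complex.Im x| <= cabs x.
Proof.
have -> : cabs x = Num.sqrt (complex.Re x ^+ 2 + complex.Im x ^+ 2).
  by rewrite /cabs normc_def.
by rewrite -sqrtr_sqr ler_sqrt ?addr_ge0 ?sqr_ge0// lerDr sqr_ge0.
Qed.

Lemma ler_cabs_ReIm x : cabs x <= `|complex.Re x| + `|complex.Im x|.
Proof.
have -> : cabs x = Num.sqrt (complex.Re x ^+ 2 + complex.Im x ^+ 2).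
  by rewrite /cabs normc_def.
rewrite -[leRHS]ger0_norm ?addr_ge0//.
rewrite -[leRHS]sqrtr_sqr ler_sqrt ?sqr_ge0//.
by rewrite sqrrD !real_normK ?num_real// -addrA lerD2l lerDr mulrn_wge0// mulr_ge0.
Qed.

Lemma ler_dist_cabs x y : `|cabs x - cabs y| <= cabs (x - y).
Proof.
rewrite ler_norml; apply/andP; split.
  rewrite lerNl opprB lerBlDr -lecR rmorphD/= -!cabsE distrC.
  by rewrite -[in leLHS](subrK x y) ler_normD.
by rewrite lerBlDr -lecR rmorphD/= -!cabsE -[in leLHS](subrK y x) ler_normD.
Qed.

Lemma cabs_nonexpansive_continuous (p : Cplx R -> R) :
  (forall x y, `|p x - p y| <= cabs (x - y)) -> continuous p.
Proof.
move=> pc x A /nbhs_ballP[e /= e0 eA]; apply/nbhs_ballP.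
(* Balls of [Cplx R] have radii in [Cplx R], so the real radius is embedded. *)
exists e%:C%C => [|y]; first by rewrite /= ltcR.
by rewrite /ball/= cabsE ltcR => xy; apply: eA; apply: le_lt_trans xy; exact: pc.
Qed.

Lemma Re_continuous : continuous (fun x : Cplx R => complex.Re x).
Proof. by apply: cabs_nonexpansive_continuous => x y; rewrite -cReB ler_norm_Re. Qed.

Lemma Im_continuous : continuous (fun x : Cplx R => complex.Im x).
Proof. by apply: cabs_nonexpansive_continuous => x y; rewrite -cImB ler_norm_Im. Qed.

Lemma cabs_continuous : continuous (@cabs R).
Proof. exact: cabs_nonexpansive_continuous ler_dist_cabs. Qed.

End ComplexNumbers.

(** * Functions continuous along the contour *)

Section LoopContinuous.
Context {R : realType} (gamma : R -> Cplx R).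

(** Only the pullback to the parameter segment is constrained, so a resolvent with its pole off the
    loop qualifies; compactness and measurability are then those of [[0, 1]]. *)
Definition loop_continuous (u : Cplx R -> Cplx R) : Prop :=
  {within `[0, 1], continuous (u \o gamma)}.

Lemma loop_continuous_cst (c : Cplx R) : loop_continuous (fun=> c).
Proof. by move=> t; exact: cvg_cst. Qed.

Lemma loop_continuousD u v :
  loop_continuous u -> loop_continuous v -> loop_continuous (fun w => u w + v w).
Proof. by move=> cu cv t; apply: cvgD; [exact: cu|exact: cv]. Qed.

Lemma loop_continuousM u v :
  loop_continuous u -> loop_continuous v -> loop_continuous (fun w => u w * v w).
Proof. by move=> cu cv t; apply: cvgM; [exact: cu|exact: cv]. Qed.

Lemma loop_continuousX u n :
  loop_continuous u -> loop_continuous (fun w => u w ^+ n).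
Proof.
move=> cu; elim: n => [|n ih]; first exact: loop_continuous_cst.
by under [X in loop_continuous X]eq_fun do rewrite exprS; exact: (loop_continuousM cu ih).
Qed.

Lemma loop_continuous_sum (I : Type) (r : seq I) (u : I -> Cplx R -> Cplx R) :
  (forall i, loop_continuous (u i)) -> loop_continuous (fun w => \sum_(i <- r) u i w).
Proof.
move=> cu; elim: r => [|i r ih].
  by under [X in loop_continuous X]eq_fun do rewrite big_nil; exact: loop_continuous_cst.
by under [X in loop_continuous X]eq_fun do rewrite big_cons; exact: (loop_continuousD (cu i) ih).
Qed.

Lemma loop_continuousV u :
  loop_continuous u -> (forall w, loop_trace gamma w -> u w != 0) ->
  loop_continuous (fun w => (u w)^-1).
Proof.
move=> cu u0; apply/subspace_continuousP => t t01.
apply: cvgV; first by apply: u0; exists t.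
by move/subspace_continuousP : cu; exact.
Qed.

Lemma loop_continuous_bounded u : loop_continuous u ->
  exists2 M : R, 0 < M & forall w, loop_trace gamma w -> cabs (u w) <= M.
Proof.
move=> cu.
have cc : {within `[0, 1], continuous (fun t : R => cabs (u (gamma t)))}.
  by move=> t; apply: continuous_comp; [exact: cu|exact: cabs_continuous].
have /compact_bounded[M [_ HM]] := continuous_compact cc (@segment_compact R 0 1).
(* [compact_bounded] gives a bound for every real strictly above [M]; this one is also positive. *)
exists (`|M| + 1) => [|w [t t01 <-]]; first by rewrite ltr_wpDl.
have := HM (`|M| + 1); rewrite (le_lt_trans (ler_norm M)) ?ltrDl//.
move=> /(_ isT _ (ex_intro2 _ _ t t01 erefl)) /=.
by rewrite ger0_norm// cabs_ge0.
Qed.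

End LoopContinuous.
Arguments loop_continuous_cst {R} gamma c.
Arguments loop_continuousX {R gamma u} n.

(** * Linearity and estimates for contour integrals *)

Section ContourIntegral.
Context {R : realType} (gamma : R -> Cplx R).
Implicit Types f g u : Cplx R -> Cplx R.

Let mu := @lebesgue_measure R.
Let I01 : set R := `[0, 1].

Let mI01 : measurable (I01 : set (measurableTypeR R)). Proof. exact: measurable_itv. Qed.

Lemma eq_contour_integrable f g :
  (forall w, loop_trace gamma w -> f w = g w) ->
  contour_integrable gamma f -> contour_integrable gamma g.
Proof.
move=> fg [fRe fIm]; split.
  by apply: eq_integrable fRe => // t /[!inE] t01 /=; rewrite fg//; exists t.
by apply: eq_integrable fIm => // t /[!inE] t01 /=; rewrite fg//; exists t.
Qed.

Lemma eq_contour_int f g :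
  (forall w, loop_trace gamma w -> f w = g w) ->
  contour_int gamma f = contour_int gamma g.
Proof.
move=> fg; congr Complex; apply: eq_Rintegral => t /[!inE] t01 /=; rewrite fg//;
  by exists t.
Qed.

Let int (f : R -> R) := mu.-integrable I01 (EFin \o f).

Let eq_int (f g : R -> R) : {in I01, f =1 g} -> int f -> int g.
Proof. by move=> fg; apply: eq_integrable => // t It /=; rewrite fg. Qed.

Let intD (f g : R -> R) : int f -> int g -> int (fun t => f t + g t).
Proof. by move=> fi gi; have := integrableD mI01 fi gi; apply: eq_integrable. Qed.

Let intB (f g : R -> R) : int f -> int g -> int (fun t => f t - g t).
Proof. by move=> fi gi; have := integrableB mI01 fi gi; apply: eq_integrable. Qed.

Let intZ (c : R) (f : R -> R) : int f -> int (fun t => c * f t).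
Proof. by move=> fi; have := integrableZl mI01 c fi; apply: eq_integrable. Qed.

Lemma contour_integrableD f g :
  contour_integrable gamma f -> contour_integrable gamma g ->
  contour_integrable gamma (fun w => f w + g w).
Proof.
move=> [fRe fIm] [gRe gIm]; split.
  by apply: eq_int (intD fRe gRe) => t _; rewrite mulrDl cReD.
by apply: eq_int (intD fIm gIm) => t _; rewrite mulrDl cImD.
Qed.

Lemma contour_intD f g :
  contour_integrable gamma f -> contour_integrable gamma g ->
  contour_int gamma (fun w => f w + g w) = contour_int gamma f + contour_int gamma g.
Proof.
move=> [fRe fIm] [gRe gIm]; apply: cplxP; rewrite ?cReD ?cImD /=.
  by rewrite -RintegralD//; apply: eq_Rintegral => t _; rewrite mulrDl cReD.
by rewrite -RintegralD//; apply: eq_Rintegral => t _; rewrite mulrDl cImD.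
Qed.

(** [p] stands for the real or the imaginary part; measurability and boundedness are what keeps a
    product with an integrable function integrable. *)
Let bounded_part (p : Cplx R -> R) u :
  continuous p -> (forall x, `|p x| <= cabs x) -> loop_continuous gamma u ->
  measurable_fun I01 (fun t => p (u (gamma t))) /\ [bounded p (u (gamma t)) | t in I01].
Proof.
move=> cp pc cu; split.
  apply: subspace_continuous_measurable_fun => // t.
  by apply: continuous_comp; [exact: cu|exact: cp].
have [M _ HM] := loop_continuous_bounded cu.
exists M; split=> [|x Mx t t01 /=]; first exact: num_real.
by apply: le_trans (pc _) (le_trans (HM _ _) (ltW Mx)); exists t.
Qed.

Let intM (f g : R -> R) :
  measurable_fun I01 f /\ [bounded f t | t in I01] -> int g ->
  int (fun t => f t * g t).
Proof. by move=> [mf bf] gi; have := integrableMr mI01 mf bf gi; apply: eq_integrable. Qed.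

Lemma contour_integrableM u f :
  loop_continuous gamma u -> contour_integrable gamma f ->
  contour_integrable gamma (fun w => u w * f w).
Proof.
move=> cu [fRe fIm].
have bR := bounded_part Re_continuous ler_norm_Re cu.
have bI := bounded_part Im_continuous ler_norm_Im cu.
split.
  by apply: eq_int (intB (intM bR fRe) (intM bI fIm)) => t _; rewrite -mulrA [RHS]cReM.
by apply: eq_int (intD (intM bR fIm) (intM bI fRe)) => t _; rewrite -mulrA [RHS]cImM.
Qed.

Lemma contour_integrableZ (c : Cplx R) f :
  contour_integrable gamma f -> contour_integrable gamma (fun w => c * f w).
Proof. by apply: contour_integrableM; exact: loop_continuous_cst. Qed.

Lemma contour_intZ (c : Cplx R) f :
  contour_integrable gamma f ->
  contour_int gamma (fun w => c * f w) = c * contour_int gamma f.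
Proof.
move=> [fRe fIm]; apply: cplxP; rewrite ?cReM ?cImM /=.
  rewrite -!RintegralZl// -RintegralB; try exact: intZ; last by [].
  by apply: eq_Rintegral => t _; rewrite -mulrA [LHS]cReM.
rewrite -!RintegralZl// -RintegralD; try exact: intZ; last by [].
by apply: eq_Rintegral => t _; rewrite -mulrA [LHS]cImM.
Qed.

(** [B] depends on [f] alone, so a kernel tending to 0 uniformly on the loop makes the integrals
    tend to 0. *)
Lemma contour_int_bound f : contour_integrable gamma f ->
  exists2 B : R, 0 <= B & forall (u : Cplx R -> Cplx R) (M : R),
    loop_continuous gamma u ->
    (forall w, loop_trace gamma w -> cabs (u w) <= M) ->
    cabs (contour_int gamma (fun w => u w * f w)) <= M * B.
Proof.
move=> fi; have [fRe fIm] := fi.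
pose q t := `|complex.Re (f (gamma t) * velocity gamma t)| +
            `|complex.Im (f (gamma t) * velocity gamma t)|.
have qi : int q by apply: intD; exact: integrable_norm.
(* One copy of the integral of [q] bounds the real part of the contour integral, the other its
   imaginary part. *)
exists (\int[mu]_(t in I01) q t + \int[mu]_(t in I01) q t).
  by rewrite addr_ge0//; apply: Rintegral_ge0 => t _; rewrite addr_ge0.
move=> u M cu uM; have [ufRe ufIm] := contour_integrableM cu fi.
have uq t : I01 t -> cabs (u (gamma t) * f (gamma t) * velocity gamma t) <= M * q t.
  move=> t01; rewrite -mulrA cabsM; apply: ler_pM; [exact: cabs_ge0|exact: cabs_ge0| |].
    by apply: uM; exists t.
  exact: ler_cabs_ReIm.
have Mqi : int (fun t => M * q t) by exact: intZ.
apply: (le_trans (ler_cabs_ReIm _)); rewrite mulrDr -RintegralZl//=; apply: lerD.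
  apply: le_trans (le_normr_Rintegral mI01 ufRe) _; apply: le_Rintegral => //.
    exact: integrable_norm ufRe.
  by move=> t t01; apply: le_trans (ler_norm_Re _) (uq _ t01).
apply: le_trans (le_normr_Rintegral mI01 ufIm) _; apply: le_Rintegral => //.
  exact: integrable_norm ufIm.
by move=> t t01; apply: le_trans (ler_norm_Im _) (uq _ t01).
Qed.

End ContourIntegral.

(** With [a = w - z] and [b = w - (h + z)], the right-hand side is the difference quotient of the
    Cauchy kernel minus its derivative, times [f]; the left-hand side exposes the factor [h]. *)
Lemma resolvent_quotient (F : fieldType) (a b f h : F) :
  a != 0 -> b != 0 -> h != 0 -> b = a - h ->
  h * (a^-1 ^+ 2 * b^-1) * f =
  h^-1 * (b^-1 * f) + (- h^-1 * (a^-1 * f) + - 1 * (a^-1 ^+ 2 * f)).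
Proof. by move=> a0 b0 h0 E; subst b; field; rewrite a0 b0 h0. Qed.

(** * Differentiability of Cauchy integrals off the contour *)

Section CauchyIntegral.
Context {R : realType} (gamma : R -> Cplx R).
Hypothesis cgamma : loop_continuous gamma (fun w => w).

Lemma loop_trace_subr_neq0 z w : ~ loop_trace gamma z -> loop_trace gamma w -> w - z != 0.
Proof. by move=> nz tw; rewrite subr_eq0; apply/eqP => wz; apply: nz; rewrite -wz. Qed.

Lemma loop_continuous_resolvent z :
  ~ loop_trace gamma z -> loop_continuous gamma (fun w => (w - z)^-1).
Proof.
move=> nz; apply: loop_continuousV => [|w]; last exact: loop_trace_subr_neq0.
exact: (loop_continuousD cgamma (loop_continuous_cst gamma (- z))).
Qed.

(** The resolvent is continuous on the compact loop, hence bounded by some [M]; its reciprocal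
    bounds the distance from below. *)
Lemma loop_trace_dist z : ~ loop_trace gamma z ->
  exists2 d : R, 0 < d & forall w, loop_trace gamma w -> d <= cabs (w - z).
Proof.
move=> nz; have [M M0 HM] := loop_continuous_bounded (loop_continuous_resolvent nz).
exists M^-1 => [|w tw]; first by rewrite invr_gt0.
by rewrite invf_ple ?posrE ?cabs_gt0 ?loop_trace_subr_neq0// -cabsV HM.
Qed.

Lemma off_loop_near z : ~ loop_trace gamma z -> \forall x \near z, ~ loop_trace gamma x.
Proof.
move=> /loop_trace_dist[d d0 Hd]; apply/nbhs_ballP.
exists d%:C%C => [|y]; first by rewrite /= ltcR.
rewrite /ball/= cabsE ltcR => xy /Hd; rewrite leNgt => /negP; apply.
by move: xy; congr (_ < _); apply: (@complexI R); rewrite -!cabsE distrC.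
Qed.

Lemma is_derive_cauchy f z : contour_integrable gamma f -> ~ loop_trace gamma z ->
  is_derive z 1 (fun x => contour_int gamma (fun w => (w - x)^-1 * f w))
    (contour_int gamma (fun w => ((w - z)^-1) ^+ 2 * f w)).
Proof.
move=> fi nz; have [d d0 Hd] := loop_trace_dist nz.
have [B B0 HB] := contour_int_bound fi.
apply/is_derive_cvgP/cvgrPdist_le => e e0.
(* For [cabs h < d / 2] the shifted pole stays at distance at least [d / 2] from the loop, so the
   error kernel divided by [h] is at most [d^-2] times [2 / d]; [B] is the factor from [f]. *)
pose K : R := 2 * d^-1 ^+ 3 * B.
have K0 : 0 <= K by rewrite mulr_ge0// mulr_ge0// exprn_ge0// invr_ge0 ltW.
have K1 : 0 < K + 1 by rewrite ltr_wpDl.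
near=> h.
have h0 : h != 0 by near: h; exact: nbhs_dnbhs_neq.
have hd : cabs h < d / 2.
  rewrite -ltcR -cabsE; near: h; apply: dnbhs0_lt.
  by rewrite ltcR divr_gt0.
(* [K] may be 0, hence the division by [K + 1]. *)
have he : `|h| < e / (K + 1)%:C%C.
  by near: h; apply: dnbhs0_lt; rewrite divr_gt0// ltcR.
have Hh w : loop_trace gamma w -> d / 2 <= cabs (w - (h + z)).
  move=> /Hd dw; have := ler_cabsD (w - (h + z)) h.
  have -> : w - (h + z) + h = w - z by rewrite opprD [- h - z]addrC addrA subrK.
  lra.
have nh : ~ loop_trace gamma (h + z).
  move=> /Hh; rewrite subrr; have -> : cabs 0 = 0 :> R by rewrite /cabs normr0.
  lra.
pose u w : Cplx R := h * ((w - z)^-1 ^+ 2 * (w - (h + z))^-1).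
have cz := loop_continuous_resolvent nz; have ch := loop_continuous_resolvent nh.
have cu : loop_continuous gamma u.
  exact: (loop_continuousM (loop_continuous_cst gamma h)
    (loop_continuousM (loop_continuousX 2 cz) ch)).
set D := contour_int _ _.
have -> : D - h^-1 *: (contour_int gamma (fun w => (w - (h + z))^-1 * f w) -
                    contour_int gamma (fun w => (w - z)^-1 * f w)) =
    - contour_int gamma (fun w => u w * f w).
  have au : contour_integrable gamma (fun w => (w - (h + z))^-1 * f w).
    exact: (contour_integrableM ch fi).
  have bu : contour_integrable gamma (fun w => (w - z)^-1 * f w).
    exact: (contour_integrableM cz fi).
  have du : contour_integrable gamma (fun w => (w - z)^-1 ^+ 2 * f w).
    exact: (contour_integrableM (loop_continuousX 2 cz) fi).
  rewrite (@eq_contour_int _ _ (fun w => u w * f w) (fun w =>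
    h^-1 * ((w - (h + z))^-1 * f w) + (- h^-1 * ((w - z)^-1 * f w) +
    - 1 * ((w - z)^-1 ^+ 2 * f w)))).
    rewrite !contour_intD ?contour_intZ//; try do ![exact: contour_integrableZ|
      apply: contour_integrableD].
    by rewrite /D [_ *: _]mulrBr; ring.
  move=> w tw; rewrite /u.
  have := loop_trace_subr_neq0 nz tw; have := loop_trace_subr_neq0 nh tw.
  by move=> ? ?; apply: resolvent_quotient => //; rewrite opprD [- h - z]addrC addrA.
rewrite normrN cabsE; apply: (@le_trans _ _ (cabs h * K)%:C%C).
  rewrite lecR /K mulrA; apply: HB => // w tw.
  rewrite /u [leLHS]cabsM ler_wpM2l ?cabs_ge0// expr2 !cabsM.
  have bd : cabs (w - z)^-1 <= d^-1.
    by rewrite cabsV lef_pV2 ?posrE ?cabs_gt0 ?loop_trace_subr_neq0// Hd.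
  have ad : cabs (w - (h + z))^-1 <= 2 * d^-1.
    rewrite cabsV (_ : 2 * d^-1 = (d / 2)^-1); last by rewrite invf_div.
    by rewrite lef_pV2 ?posrE ?divr_gt0 ?cabs_gt0 ?loop_trace_subr_neq0// Hh.
  rewrite [leRHS](_ : _ = d^-1 * d^-1 * (2 * d^-1)); last by ring.
  by do ![apply: ler_pM => //; rewrite ?mulr_ge0 ?cabs_ge0//].
rewrite rmorphM/= -cabsE; apply: (@le_trans _ _ (e / (K + 1)%:C%C * K%:C%C)).
  by apply: ler_wpM2r; [rewrite ler0c|exact: ltW].
rewrite mulrAC ler_pdivrMr ?ltcR// ler_wpM2l ?(ltW e0)//.
by rewrite lecR lerDl.
Unshelve. all: by end_near. Qed.

End CauchyIntegral.

Section ContourSum.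
Context {R : realType} (gamma : R -> Cplx R).

Lemma contour_integrable0 : contour_integrable gamma (fun=> 0).
Proof.
by split; have := integrable0 (@lebesgue_measure R) `[0, 1]%classic;
  apply: eq_integrable => [|t _]; rewrite ?/comp ?mul0r.
Qed.

Lemma contour_int0 : contour_int gamma (fun=> 0) = 0.
Proof.
rewrite -[RHS](mul0r (contour_int gamma (fun=> 0))) -(contour_intZ 0 contour_integrable0).
by apply: eq_contour_int => w _; rewrite mul0r.
Qed.

Lemma contour_integrable_sum (I : Type) (r : seq I) (f : I -> Cplx R -> Cplx R) :
  (forall i, contour_integrable gamma (f i)) ->
  contour_integrable gamma (fun w => \sum_(i <- r) f i w).
Proof.
move=> fi; elim: r => [|i r ih].
  by apply: eq_contour_integrable contour_integrable0 => w _; rewrite big_nil.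
by apply: eq_contour_integrable (contour_integrableD (fi i) ih) => w _; rewrite big_cons.
Qed.

Lemma contour_int_sum (I : Type) (r : seq I) (f : I -> Cplx R -> Cplx R) :
  (forall i, contour_integrable gamma (f i)) ->
  contour_int gamma (fun w => \sum_(i <- r) f i w) =
  \sum_(i <- r) contour_int gamma (f i).
Proof.
move=> fi; elim: r => [|i r ih].
  rewrite big_nil -[RHS]contour_int0; apply: eq_contour_int => w _.
  by rewrite big_nil.
rewrite big_cons -ih -contour_intD//; last exact: contour_integrable_sum.
by apply: eq_contour_int => w _; rewrite big_cons.
Qed.

End ContourSum.

(** * Entrywise integration of matrix functions, with factors on either side *)

Section MatrixContourIntegral.
Context {R : realType} (gamma : R -> Cplx R).
Local Notation mint := (mx_contour_int gamma).

Definition mx_loop_continuous (m n : nat) (A : Cplx R -> 'M[Cplx R]_(m, n)) : Prop :=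
  forall i j, loop_continuous gamma (fun w => A w i j).

Definition mx_contour_integrable (m n : nat) (F : Cplx R -> 'M[Cplx R]_(m, n)) : Prop :=
  forall i j, contour_integrable gamma (fun w => F w i j).

Lemma eq_mx_contour_int (m n : nat) (F G : Cplx R -> 'M[Cplx R]_(m, n)) :
  (forall w, loop_trace gamma w -> F w = G w) -> mint F = mint G.
Proof.
move=> FG; apply/matrixP => i j; rewrite !mxE; congr (_ * _).
by apply: eq_contour_int => w /FG ->.
Qed.

Lemma mx_loop_continuous_cst (m n : nat) (A : 'M[Cplx R]_(m, n)) :
  mx_loop_continuous (fun=> A).
Proof. by move=> i j; exact: loop_continuous_cst. Qed.

Lemma mx_contour_integrable_mull (m n p : nat) (A : Cplx R -> 'M[Cplx R]_(m, n))
    (F : Cplx R -> 'M[Cplx R]_(n, p)) :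
  mx_loop_continuous A -> mx_contour_integrable F ->
  mx_contour_integrable (fun w => A w *m F w).
Proof.
move=> cA Fi i j.
have := contour_integrable_sum (index_enum 'I_n)
  (fun k => contour_integrableM (cA i k) (Fi k j)).
by apply: eq_contour_integrable => w _; rewrite mxE.
Qed.

Lemma mx_contour_integrable_mulr (m n p : nat) (F : Cplx R -> 'M[Cplx R]_(m, n))
    (A : Cplx R -> 'M[Cplx R]_(n, p)) :
  mx_loop_continuous A -> mx_contour_integrable F ->
  mx_contour_integrable (fun w => F w *m A w).
Proof.
move=> cA Fi i j.
have := contour_integrable_sum (index_enum 'I_n)
  (fun k => contour_integrableM (cA k j) (Fi i k)).
by apply: eq_contour_integrable => w _; rewrite mxE; apply: eq_bigr => k _; rewrite mulrC.
Qed.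

Lemma mx_contour_integrable_scale (m n : nat) (u : Cplx R -> Cplx R)
    (F : Cplx R -> 'M[Cplx R]_(m, n)) :
  loop_continuous gamma u -> mx_contour_integrable F ->
  mx_contour_integrable (fun w => u w *: F w).
Proof.
move=> cu Fi i j; have := contour_integrableM cu (Fi i j).
by apply: eq_contour_integrable => w _; rewrite mxE.
Qed.

Lemma mx_contour_intD (m n : nat) (F G : Cplx R -> 'M[Cplx R]_(m, n)) :
  mx_contour_integrable F -> mx_contour_integrable G ->
  mint (fun w => F w + G w) = mint F + mint G.
Proof.
move=> Fi Gi; apply/matrixP => i j; rewrite !mxE -mulrDr -contour_intD; [|exact: Fi|exact: Gi].
by congr (_ * _); apply: eq_contour_int => w _; rewrite mxE.
Qed.

Lemma mx_contour_int_sum (m n : nat) (I : Type) (r : seq I)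
    (F : I -> Cplx R -> 'M[Cplx R]_(m, n)) :
  (forall k, mx_contour_integrable (F k)) ->
  mint (fun w => \sum_(k <- r) F k w) = \sum_(k <- r) mint (F k).
Proof.
move=> Fi; apply/matrixP => i j; rewrite mxE summxE.
under [RHS]eq_bigr do rewrite mxE; rewrite -mulr_sumr -contour_int_sum; last first.
  by move=> k; exact: Fi.
by congr (_ * _); apply: eq_contour_int => w _; rewrite summxE.
Qed.

Lemma mx_contour_int_mull (m n p : nat) (A : 'M[Cplx R]_(m, n))
    (F : Cplx R -> 'M[Cplx R]_(n, p)) :
  mx_contour_integrable F -> mint (fun w => A *m F w) = A *m mint F.
Proof.
move=> Fi; apply/matrixP => i j; rewrite !mxE.
transitivity ((twopii R)^-1 * \sum_k A i k * contour_int gamma (fun w => F w k j)).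
  congr (_ * _); under [RHS]eq_bigr do rewrite -contour_intZ//.
  rewrite -contour_int_sum => [|k]; last exact: contour_integrableZ.
  by apply: eq_contour_int => w _; rewrite mxE.
by rewrite mulr_sumr; apply: eq_bigr => k _; rewrite mxE mulrCA.
Qed.

Lemma mx_contour_int_mulr (m n p : nat) (F : Cplx R -> 'M[Cplx R]_(m, n))
    (A : 'M[Cplx R]_(n, p)) :
  mx_contour_integrable F -> mint (fun w => F w *m A) = mint F *m A.
Proof.
move=> Fi; apply/matrixP => i j; rewrite !mxE.
transitivity ((twopii R)^-1 * \sum_k A k j * contour_int gamma (fun w => F w i k)).
  congr (_ * _); under [RHS]eq_bigr do rewrite -contour_intZ//.
  rewrite -contour_int_sum => [|k]; last exact: contour_integrableZ.
  by apply: eq_contour_int => w _; rewrite mxE; apply: eq_bigr => k _; rewrite mulrC.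
by rewrite mulr_sumr; apply: eq_bigr => k _; rewrite mxE mulrA mulrAC.
Qed.

End MatrixContourIntegral.
Arguments mx_loop_continuous_cst {R} gamma {m n} A.

(** * Biorthogonality *)

Section DividedDifference.
Context {R : realType} {N : nat}.
Implicit Types (P : {poly 'M[Cplx R]_N.+1}) (w z : Cplx R).

(** Scalar matrices are central, so evaluation at [w%:M] becomes scaling of the coefficients, and
    left and right evaluation agree. *)
Lemma mxpoly_eval_wide P m w : (size P <= m)%N ->
  mxpoly_eval P w = \sum_(i < m) w ^+ i *: P`_i.
Proof.
move=> sP; rewrite /mxpoly_eval (horner_coef_wide _ sP); apply: eq_bigr => i _.
by rewrite -rmorphXn /= -[LHS]/(P`_i *m (w ^+ i)%:M) mul_mx_scalar.
Qed.

(** [(P(w) - P(z)) / (w - z)] for [P] of degree less than [m]. *)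
Definition mxpoly_divdiff P (m : nat) z w : 'M[Cplx R]_N.+1 :=
  \sum_(i < m) \sum_(j < i) (w ^+ (i.-1 - j) * z ^+ j) *: P`_i.

(** Coefficient by coefficient this is the factorization of [w ^+ i - z ^+ i]. The truncated
    exponent [i.-1 - j] is harmless at [i = 0], where the inner sum is empty. *)
Lemma mxpoly_divdiffE P m z w : (size P <= m)%N ->
  mxpoly_eval P w - mxpoly_eval P z = (w - z) *: mxpoly_divdiff P m z w.
Proof.
move=> sP; rewrite !(mxpoly_eval_wide _ sP) -sumrB scaler_sumr; apply: eq_bigr => i _.
by rewrite -scalerBl subrXX -scalerA scaler_suml.
Qed.

Lemma derivable_mxpoly_eval P z : derivable (mxpoly_eval P) z 1.
Proof.
suff : is_derive z 1 (mxpoly_eval P) (\matrix_(i, j) 'D_1 (fun w => mxpoly_eval P w i j) z).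
  by case.
apply/is_derive_mxP => i j; rewrite mxE; apply: derivableP.
have -> : (fun w => mxpoly_eval P w i j) =
    (fun w => \sum_(k < size P) (w ^+ k * P`_k i j)).
  by apply/funext => w; rewrite (mxpoly_eval_wide _ (leqnn _)) summxE;
    apply: eq_bigr => k _; rewrite mxE.
apply: derivable_bigsum => k.
exact: derivable_monomial.
Qed.

Context (gamma : R -> Cplx R).
Hypothesis cgamma : loop_continuous gamma (fun w => w).

Lemma mx_loop_continuous_eval P : mx_loop_continuous gamma (mxpoly_eval P).
Proof.
move=> i j.
have -> : (fun w => mxpoly_eval P w i j) =
    (fun w => \sum_(k < size P) (w ^+ k * P`_k i j)).
  by apply/funext => w; rewrite (mxpoly_eval_wide _ (leqnn _)) summxE;
    apply: eq_bigr => k _; rewrite mxE.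
apply: loop_continuous_sum => k.
exact: (loop_continuousM (loop_continuousX k cgamma) (loop_continuous_cst gamma (P`_k i j))).
Qed.

Lemma mx_loop_continuous_divdiff P m z :
  mx_loop_continuous gamma (mxpoly_divdiff P m z).
Proof.
move=> i j.
have -> : (fun w => mxpoly_divdiff P m z w i j) =
    (fun w => \sum_(k < m) \sum_(l < k) (w ^+ (k.-1 - l) * (z ^+ l * P`_k i j))).
  apply/funext => w; rewrite summxE; apply: eq_bigr => k _; rewrite summxE.
  by apply: eq_bigr => l _; rewrite mxE mulrA.
apply: loop_continuous_sum => k; apply: loop_continuous_sum => l.
exact: (loop_continuousM (loop_continuousX (k.-1 - l) cgamma)
  (loop_continuous_cst gamma (z ^+ l * P`_k i j))).
Qed.

(** For [j < i <= n + 1] the exponent [i - 1 - j] never exceeds [n], and it equals [n] only at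
    [i = n + 1], [j = 0]. *)
Lemma sum_divdiff_top (V : zmodType) (n : nat) (T : nat -> nat -> V) :
  (forall i j, (i.-1 - j <= n)%N -> (i.-1 - j != n)%N -> T i j = 0) ->
  \sum_(i < n.+2) \sum_(j < i) T i j = T n.+1 0%N.
Proof.
move=> T0; rewrite big_ord_recr /= [X in _ + X]big_ord_recl /= big1 ?add0r => [|i _].
  rewrite big1 ?addr0// => j _; have := ltn_ord j.
  by move=> jn; apply: T0; rewrite /bump /=; lia.
rewrite big1// => j _; have := ltn_ord i; have := ltn_ord j.
by move=> ji iN; apply: T0; lia.
Qed.

Section Pairing.
Variables (F : Cplx R -> 'M[Cplx R]_N.+1) (n : nat) (X : 'M[Cplx R]_N.+1).
Hypothesis Fi : mx_contour_integrable gamma F.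
Hypothesis FX : forall k, (k <= n)%N ->
  mx_contour_int gamma (fun w => w ^+ k *: F w) = (n == k)%:R *: X.

Let FXi k : mx_contour_integrable gamma (fun w => w ^+ k *: F w).
Proof. exact: (mx_contour_integrable_scale (loop_continuousX k cgamma) Fi). Qed.

(* By orthogonality, only the term [w ^+ n] of the divided difference survives. *)
Lemma mx_contour_int_divdiffr P z :
  mx_contour_int gamma (fun w => F w *m mxpoly_divdiff P n.+2 z w) = X *m P`_n.+1.
Proof.
(* The power of [w] stays with [F], where the moment hypothesis applies; the factor constant in [w]
   is kept on the right. *)
pose G (i j : nat) w := (w ^+ (i.-1 - j) *: F w) *m (z ^+ j *: P`_i).
have Gi i j : mx_contour_integrable gamma (G i j).
  exact: (mx_contour_integrable_mulr (mx_loop_continuous_cst gamma (z ^+ j *: P`_i))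
    (FXi (i.-1 - j))).
have GE i j : (i.-1 - j <= n)%N ->
    mx_contour_int gamma (G i j) = (n == i.-1 - j)%N%:R *: (X *m (z ^+ j *: P`_i)).
  by move=> ij; rewrite (mx_contour_int_mulr _ (FXi _)) FX// -scalemxAl.
transitivity (\sum_(i < n.+2) \sum_(j < i) mx_contour_int gamma (G i j)).
  under eq_bigr do rewrite -mx_contour_int_sum//.
  rewrite -mx_contour_int_sum; last first.
    move=> i k l; have := contour_integrable_sum (index_enum 'I_i) (fun j => Gi i j k l).
    by apply: eq_contour_integrable => w _; rewrite summxE.
  apply: eq_mx_contour_int => w _; rewrite mulmx_sumr; apply: eq_bigr => i _.
  rewrite mulmx_sumr; apply: eq_bigr => j _.
  by rewrite /G -!scalemxAr -!scalemxAl !scalerA mulrC.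
rewrite (@sum_divdiff_top _ n (fun i j => mx_contour_int gamma (G i j))) => [|i j lt_in ijn].
  by rewrite GE ?subn0// eqxx scale1r expr0 scale1r.
by rewrite GE// eq_sym (negbTE ijn) scale0r.
Qed.

(** The mirror image is needed because matrices do not commute: here [F] will be [W P^R], in the
    right-handed version [P^L W]. *)
Lemma mx_contour_int_divdiffl P z :
  mx_contour_int gamma (fun w => mxpoly_divdiff P n.+2 z w *m F w) = P`_n.+1 *m X.
Proof.
pose G (i j : nat) w := (z ^+ j *: P`_i) *m (w ^+ (i.-1 - j) *: F w).
have Gi i j : mx_contour_integrable gamma (G i j).
  exact: (mx_contour_integrable_mull (mx_loop_continuous_cst gamma (z ^+ j *: P`_i))
    (FXi (i.-1 - j))).
have GE i j : (i.-1 - j <= n)%N ->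
    mx_contour_int gamma (G i j) = (n == i.-1 - j)%N%:R *: ((z ^+ j *: P`_i) *m X).
  by move=> ij; rewrite (mx_contour_int_mull _ (FXi _)) FX// -scalemxAr.
transitivity (\sum_(i < n.+2) \sum_(j < i) mx_contour_int gamma (G i j)).
  under eq_bigr do rewrite -mx_contour_int_sum//.
  rewrite -mx_contour_int_sum; last first.
    move=> i k l; have := contour_integrable_sum (index_enum 'I_i) (fun j => Gi i j k l).
    by apply: eq_contour_integrable => w _; rewrite summxE.
  apply: eq_mx_contour_int => w _; rewrite mulmx_suml; apply: eq_bigr => i _.
  rewrite mulmx_suml; apply: eq_bigr => j _.
  by rewrite /G -!scalemxAr -!scalemxAl !scalerA.
rewrite (@sum_divdiff_top _ n (fun i j => mx_contour_int gamma (G i j))) => [|i j lt_in ijn].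
  by rewrite GE ?subn0// eqxx scale1r expr0 scale1r.
by rewrite GE// eq_sym (negbTE ijn) scale0r.
Qed.

End Pairing.

End DividedDifference.
Arguments mx_loop_continuous_eval {R N gamma} cgamma P.
Arguments mx_loop_continuous_divdiff {R N gamma} cgamma P m z.

Lemma loop_continuous_id (R : realType) (gamma : R -> Cplx R) :
  loop_around_infinity gamma -> loop_continuous gamma (fun w => w).
Proof.
case=> _ _ [K HK] _; apply/subspace_continuousP => t t01 A /nbhs_ballP[e /= e0 eA].
(* A positive element of [Cplx R] is real, so the radius comes from [R]. *)
have [e' e'E] : exists e' : R, e = e'%:C%C by exists (complex.Re e); rewrite RRe_real// gtr0_real.
have e'0 : 0 < e' by rewrite -ltcR -e'E.
(* The Lipschitz constant comes without a sign, and a positive divisor is needed. *)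
have K1 : 0 < `|K| + 1 by rewrite ltr_wpDl.
apply/nbhs_ballP; exists (e' / (`|K| + 1)); first by rewrite /= divr_gt0.
move=> s ts s01; apply: eA; rewrite /ball/= e'E cabsE ltcR.
apply: (le_lt_trans (HK t s _ _)); [by rewrite inE|by rewrite inE|].
move: ts; rewrite /ball/= ltr_pdivlMr// mulrC; apply: le_lt_trans.
by rewrite ler_wpM2r// (le_trans (ler_norm K))// lerDl.
Qed.

(** Here [p], [q], [r], [s] are [P_n^L], [Q_n^L], [P_n^R], [Q_n^R] at a point, the suffix 1 marks
    index [n + 1], and [c] is [C_n]; the two matrices are [Y_(n+1)^L] and [Y_(n+1)^R]. One product
    suffices for each, since a one-sided inverse of a square matrix is two-sided. *)
Lemma block_wronskian_unit (K : fieldType) (N : nat)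
    (p p1 q q1 r r1 s s1 c : 'M[K]_N) :
  c \in unitmx -> q *m r = p *m s -> q1 *m r1 = p1 *m s1 ->
  q1 *m r - p1 *m s = invmx c -> p *m s1 - q *m r1 = invmx c ->
  block_mx p1 q1 (- c *m p) (- c *m q) \in unitmx /\
  block_mx r1 (- r *m c) s1 (- s *m c) \in unitmx.
Proof.
move=> uc qr q1r1 lo up; split.
  (* With [J = [[0, 1], [-1, 0]]], the second factor is [J Y^R J^-1]. *)
  have E : block_mx p1 q1 (- c *m p) (- c *m q) *m
      block_mx (- s *m c) (- s1) (r *m c) r1 = 1%:M.
    rewrite mulmx_block [RHS]scalar_mx_block; congr block_mx.
    - by rewrite !mulmxA mulmxN -mulmxDl addrC lo mulVmx.
    - by rewrite mulmxN q1r1 addNr.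
    - by rewrite !mulNmx mulmxN opprK -!mulmxA (mulmxA p) -qr -mulmxA subrr.
    - by rewrite !mulNmx mulmxN opprK -!mulmxA -mulmxBr up mulmxV.
  by have [] := mulmx1_unit E.
(* The first factor is [J^-1 Y^L J]. *)
have E : block_mx (- c *m q) (c *m p) (- q1) p1 *m
    block_mx r1 (- r *m c) s1 (- s *m c) = 1%:M.
  rewrite mulmx_block [RHS]scalar_mx_block; congr block_mx.
  - by rewrite !mulNmx -!mulmxA addrC -mulmxBr up mulmxV.
  - by rewrite !mulNmx !mulmxN opprK -!mulmxA (mulmxA q) qr -mulmxA subrr.
  - by rewrite mulNmx q1r1 addNr.
  - by rewrite !mulNmx !mulmxN opprK !mulmxA -mulmxBl lo mulVmx.
by have [] := mulmx1_unit E.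
Qed.

(** * Bilinear identities and invertibility of [Y_n] *)

Section Biorthogonal.
Context {R : realType} {N : nat} (gamma : R -> Cplx R).
Context (W : Cplx R -> 'M[Cplx R]_N.+1) (PL PR : nat -> {poly 'M[Cplx R]_N.+1}).
Context (C : nat -> 'M[Cplx R]_N.+1).
Hypothesis cgamma : loop_continuous gamma (fun w => w).
Hypothesis Wi : mx_contour_integrable gamma W.
Hypothesis hP : biorthogonal gamma W PL PR C.

Lemma mx_contour_integrable_PL n :
  mx_contour_integrable gamma (fun w => mxpoly_eval (PL n) w *m W w).
Proof. exact: (mx_contour_integrable_mull (mx_loop_continuous_eval cgamma (PL n)) Wi). Qed.

Lemma mx_contour_integrable_PR n :
  mx_contour_integrable gamma (fun w => W w *m mxpoly_eval (PR n) w).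
Proof. exact: (mx_contour_integrable_mulr (mx_loop_continuous_eval cgamma (PR n)) Wi). Qed.

Lemma derivable_mx_cauchy (F : Cplx R -> 'M[Cplx R]_N.+1) z :
  mx_contour_integrable gamma F -> ~ loop_trace gamma z ->
  derivable (fun x => mx_contour_int gamma (fun w => (w - x)^-1 *: F w)) z 1.
Proof.
move=> Fi nz; set Q := fun x => _.
suff : is_derive z 1 Q (\matrix_(i, j) 'D_1 (fun w => Q w i j) z) by case.
apply/is_derive_mxP => i j; rewrite mxE; apply: derivableP.
have [d _] := is_derive_cauchy cgamma (Fi i j) nz.
have -> : (fun x => Q x i j) = (fun x => (twopii R)^-1 *
    contour_int gamma (fun w => (w - x)^-1 * F w i j)).
  apply/funext => x; rewrite mxE; congr (_ * _).
  by apply: eq_contour_int => w _; rewrite mxE.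
exact: (derivable_mull (c := (twopii R)^-1) d).
Qed.

(* Replacing [P_n^L(z)] by [P_n^L(w) - (w - z) D_n(w)], and likewise for [P_m^R],
   cancels the Cauchy kernel. *)
Lemma second_kind_bilinear n m z : ~ loop_trace gamma z -> (n <= m.+1)%N -> (m <= n.+1)%N ->
  QL gamma W PL n z *m mxpoly_eval (PR m) z - mxpoly_eval (PL n) z *m QR gamma W PR m z =
  (PL n)`_m.+1 *m invmx (C m) - invmx (C n) *m (PR m)`_n.+1.
Proof.
move=> nz nm mn.
have [[_ sL] _ _ oL _] := hP n; have [_ [_ sR] _ _ oR] := hP m.
have FLi := mx_contour_integrable_PL n; have FRi := mx_contour_integrable_PR m.
(* The bounds on [n] and [m] keep the powers of [w] in each divided difference within the range
   where biorthogonality evaluates them. *)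
have sL' : (size (PL n) <= m.+2)%N by rewrite sL.
have sR' : (size (PR m) <= n.+2)%N by rewrite sR.
rewrite -(mx_contour_int_divdiffl cgamma FRi oR (PL n) z).
rewrite -(mx_contour_int_divdiffr cgamma FLi oL (PR m) z).
have cr := loop_continuous_resolvent cgamma nz.
rewrite /QL /QR.
have FLr := mx_contour_integrable_scale cr FLi.
have FRr := mx_contour_integrable_scale cr FRi.
rewrite -(mx_contour_int_mulr _ FLr) -(mx_contour_int_mull _ FRr).
have cL := mx_loop_continuous_divdiff cgamma (PL n) m.+2 z.
have cR := mx_loop_continuous_divdiff cgamma (PR m) n.+2 z.
(* Moving the subtracted terms across leaves a sum of two integrals on each side, so the integrands
   can be compared pointwise. *)
apply/eqP; rewrite subr_eq addrAC eq_sym subr_eq eq_sym; apply/eqP.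
rewrite -(mx_contour_intD
  (mx_contour_integrable_mulr (mx_loop_continuous_cst gamma (mxpoly_eval (PR m) z)) FLr)
  (mx_contour_integrable_mulr cR FLi)).
rewrite -(mx_contour_intD (mx_contour_integrable_mull cL FRi)
  (mx_contour_integrable_mull (mx_loop_continuous_cst gamma (mxpoly_eval (PL n) z)) FRr)).
apply: eq_mx_contour_int => w tw.
have wz := loop_trace_subr_neq0 nz tw.
have EL := mxpoly_divdiffE z w sL'; have ER := mxpoly_divdiffE z w sR'.
have {}EL : mxpoly_divdiff (PL n) m.+2 z w =
    (w - z)^-1 *: (mxpoly_eval (PL n) w - mxpoly_eval (PL n) z).
  by rewrite EL scalerA mulVf// scale1r.
have {}ER : mxpoly_divdiff (PR m) n.+2 z w =
    (w - z)^-1 *: (mxpoly_eval (PR m) w - mxpoly_eval (PR m) z).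
  by rewrite ER scalerA mulVf// scale1r.
(* Both integrands collapse to [(w - z)^-1] times [P_n^L(w) W(w) P_m^R(w)]. *)
rewrite EL ER -!scalemxAl -!scalemxAr -!scalerDr; congr (_ *: _).
by rewrite mulmxBr mulmxBl !mulmxA subrK addrC subrK.
Qed.

Lemma polyL_lead n : (PL n)`_n = 1%:M.
Proof. by have [[/monicP]] := hP n; rewrite /lead_coef => + sL; rewrite sL. Qed.

Lemma polyR_lead n : (PR n)`_n = 1%:M.
Proof. by have [_ [/monicP]] := hP n; rewrite /lead_coef => + sL; rewrite sL. Qed.

Lemma polyL_gt n k : (n < k)%N -> (PL n)`_k = 0.
Proof. by move=> nk; have [[_ sL] _ _ _ _] := hP n; rewrite nth_default// sL. Qed.

Lemma polyR_gt n k : (n < k)%N -> (PR n)`_k = 0.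
Proof. by move=> nk; have [_ [_ sR] _ _ _] := hP n; rewrite nth_default// sR. Qed.

Lemma mxpoly_evalL0 z : mxpoly_eval (PL 0) z = 1%:M.
Proof.
have [[_ sL] _ _ _ _] := hP 0%N.
by rewrite (@mxpoly_eval_wide _ _ _ 1) ?sL// big_ord1 expr0 scale1r polyL_lead.
Qed.

Lemma mxpoly_evalR0 z : mxpoly_eval (PR 0) z = 1%:M.
Proof.
have [_ [_ sR] _ _ _] := hP 0%N.
by rewrite (@mxpoly_eval_wide _ _ _ 1) ?sR// big_ord1 expr0 scale1r polyR_lead.
Qed.

(** For equal indices both coefficients in the bilinear identity lie above the degree. Raising one
    index by one turns exactly one of them into a leading coefficient, which yields the lower and
    upper identities. *)
Lemma second_kind_diag n z : ~ loop_trace gamma z ->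
  QL gamma W PL n z *m mxpoly_eval (PR n) z = mxpoly_eval (PL n) z *m QR gamma W PR n z.
Proof.
move=> nz; apply/eqP; rewrite -subr_eq0 second_kind_bilinear//.
by rewrite polyL_gt// polyR_gt// mul0mx mulmx0 subrr.
Qed.

Lemma second_kind_lower n z : ~ loop_trace gamma z ->
  QL gamma W PL n.+1 z *m mxpoly_eval (PR n) z -
  mxpoly_eval (PL n.+1) z *m QR gamma W PR n z = invmx (C n).
Proof.
move=> nz; rewrite second_kind_bilinear ?(leqW (leqnSn n))//.
by rewrite polyL_lead polyR_gt// mul1mx mulmx0 subr0.
Qed.

Lemma second_kind_upper n z : ~ loop_trace gamma z ->
  mxpoly_eval (PL n) z *m QR gamma W PR n.+1 z -
  QL gamma W PL n z *m mxpoly_eval (PR n.+1) z = invmx (C n).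
Proof.
move=> nz; rewrite -opprB second_kind_bilinear ?(leqW (leqnSn n))//.
by rewrite polyL_gt// polyR_lead mulmx1 mul0mx sub0r opprK.
Qed.

Lemma YL_YR_unit n z : ~ loop_trace gamma z ->
  YL gamma W PL C n z \in unitmx /\ YR gamma W PR C n z \in unitmx.
Proof.
move=> nz; case: n => [|n].
  (* The conventions for index -1 make both matrices block triangular with identity diagonal
     blocks. *)
  split; rewrite /= unitmxE.
    by rewrite mxpoly_evalL0 det_ublock !det1 mulr1 unitr1.
  by rewrite mxpoly_evalR0 det_lblock !det1 mulr1 unitr1.
have [_ _ uC _ _] := hP n.
exact: (block_wronskian_unit uC (second_kind_diag n nz) (second_kind_diag n.+1 nz)
  (second_kind_lower n nz) (second_kind_upper n nz)).
Qed.

End Biorthogonal.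

(** * The structure equations *)

Section StructureEquation.
Context {K : numFieldType} {n : nat}.
Variables (Y : K -> 'M[K]_(n + n)) (U V : K -> 'M[K]_n) (hU hV : 'M[K]_n) (z : K).
Hypotheses (dY : derivable Y z 1) (dU : derivable U z 1) (dV : derivable V z 1).
Hypotheses (uU : \forall x \near z, U x \in unitmx) (uV : \forall x \near z, V x \in unitmx).
Hypothesis uY : Y z \in unitmx.
Hypothesis eU : z ^+ 2 *: derive1 U z = hU *m U z.
Hypothesis eV : z ^+ 2 *: derive1 V z = V z *m hV.

Let is_derive1 m p (F : K -> 'M[K]_(m, p)) : derivable F z 1 -> is_derive z 1 F (derive1 F z).
Proof. by move=> dF; rewrite derive1E; exact: derivableP. Qed.

Let is_derive1E m p (F : K -> 'M[K]_(m, p)) F' : is_derive z 1 F F' -> derive1 F z = F'.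
Proof. by move=> [_ <-]; rewrite derive1E. Qed.

Let uUz : U z \in unitmx. Proof. exact: nbhs_singleton uU. Qed.
Let uVz : V z \in unitmx. Proof. exact: nbhs_singleton uV. Qed.

(** Inverting [V] moves its equation to the other side with a sign: [z^2 (V^-1)' = - hV V^-1]. Hence
    the diagonal factor [D] satisfies [z^2 D' = H D] with [H] the block diagonal matrix of [hU] and
    [- hV], and [z^2 Z' = (z^2 Y' + Y H) D]. *)
Lemma structure_equation_left (Z := fun x => Y x *m block_mx (U x) 0 0 (invmx (V x))) :
  Z z \in unitmx /\
  z ^+ 2 *: derive1 Y z + Y z *m block_mx hU 0 0 (- hV) =
  (z ^+ 2 *: (derive1 Z z *m invmx (Z z))) *m Y z.
Proof.
pose D x : 'M[K]_(n + n) := block_mx (U x) 0 0 (invmx (V x)).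
have uD : D z \in unitmx.
  by rewrite unitmxE det_ublock unitrM -!unitmxE uUz unitmx_inv uVz.
have uZ : Z z \in unitmx by rewrite unitmx_mul uY.
split=> //.
have dD := is_derive_block_mx (is_derive1 dU) (is_derive_cst (0 : 'M[K]_n) z 1)
  (is_derive_cst (0 : 'M[K]_n) z 1) (is_derive_invmx (is_derive1 dV) uV).
rewrite (is_derive1E (is_derive_mulmx (is_derive1 dY) dD)).
rewrite scalemxAl scalerDr scalemxAl scalemxAr scale_block_mx !scaler0 eU.
rewrite scalerN scalemxAl scalemxAr eV mulKmx//.
have -> : block_mx (hU *m U z) 0 0 (- (hV *m invmx (V z))) =
    block_mx hU 0 0 (- hV) *m D z.
  by rewrite mulmx_block !mulmx0 !mul0mx !addr0 !add0r mulNmx.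
rewrite -[block_mx (U z) _ _ _]/(D z).
rewrite mulmxA -mulmxDl -!mulmxA -[LHS]mulmx1; congr (_ *m _).
(* As [Z z = Y z *m D z], the matrix [invmx (Z z) *m Y z] is a left inverse of [D z], hence also a
   right inverse. *)
by apply/esym/mulmx1C; rewrite -mulmxA mulVmx.
Qed.

(** [U] and [V] exchange roles and all products are reversed: now [z^2 D' = D H]. *)
Lemma structure_equation_right (Z := fun x => block_mx (V x) 0 0 (invmx (U x)) *m Y x) :
  Z z \in unitmx /\
  z ^+ 2 *: derive1 Y z + block_mx hV 0 0 (- hU) *m Y z =
  Y z *m (z ^+ 2 *: (invmx (Z z) *m derive1 Z z)).
Proof.
pose D x : 'M[K]_(n + n) := block_mx (V x) 0 0 (invmx (U x)).
have uD : D z \in unitmx.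
  by rewrite unitmxE det_ublock unitrM -!unitmxE uVz unitmx_inv uUz.
have uZ : Z z \in unitmx by rewrite unitmx_mul uY andbT.
split=> //.
have dD := is_derive_block_mx (is_derive1 dV) (is_derive_cst (0 : 'M[K]_n) z 1)
  (is_derive_cst (0 : 'M[K]_n) z 1) (is_derive_invmx (is_derive1 dU) uU).
rewrite (is_derive1E (is_derive_mulmx dD (is_derive1 dY))).
rewrite scalemxAr scalerDr [in RHS]scalemxAl scalemxAr scale_block_mx !scaler0 eV.
rewrite scalerN scalemxAl scalemxAr eU [invmx (U z) *m _]mulmxA mulmxK//.
have -> : block_mx (V z *m hV) 0 0 (- (invmx (U z) *m hU)) =
    D z *m block_mx hV 0 0 (- hU).
  by rewrite mulmx_block !mulmx0 !mul0mx !addr0 !add0r mulmxN.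
rewrite -[block_mx (V z) _ _ _]/(D z).
rewrite -mulmxA -mulmxDr !mulmxA addrC -[LHS]mul1mx; congr (_ *m _).
by apply/esym/mulmx1C; rewrite mulmxA mulmxV.
Qed.

End StructureEquation.

(** * Differentiability of [Y_n] off the contour *)

Section DerivableY.
Context {R : realType} {N : nat} (gamma : R -> Cplx R).
Context (W : Cplx R -> 'M[Cplx R]_N.+1) (PL PR : nat -> {poly 'M[Cplx R]_N.+1}).
Context (C : nat -> 'M[Cplx R]_N.+1).
Hypothesis cgamma : loop_continuous gamma (fun w => w).
Hypothesis Wi : mx_contour_integrable gamma W.

Lemma derivable_YL n z : ~ loop_trace gamma z -> derivable (YL gamma W PL C n) z 1.
Proof.
move=> nz.
have dP k : derivable (mxpoly_eval (PL k)) z 1 by exact: derivable_mxpoly_eval.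
have dQ k : derivable (QL gamma W PL k) z 1.
  exact: (derivable_mx_cauchy cgamma (mx_contour_integrable_PL PL cgamma Wi k) nz).
case: n => [|n].
  exact: (derivable_block_mx (dP 0%N) (dQ 0%N) (derivable_cst 0 z 1) (derivable_cst 1%:M z 1)).
exact: (derivable_block_mx (dP n.+1) (dQ n.+1)
  (derivable_mulmx (derivable_cst (- C n) z 1) (dP n))
  (derivable_mulmx (derivable_cst (- C n) z 1) (dQ n))).
Qed.

Lemma derivable_YR n z : ~ loop_trace gamma z -> derivable (YR gamma W PR C n) z 1.
Proof.
move=> nz.
have dP k : derivable (mxpoly_eval (PR k)) z 1 by exact: derivable_mxpoly_eval.
have dQ k : derivable (QR gamma W PR k) z 1.
  exact: (derivable_mx_cauchy cgamma (mx_contour_integrable_PR PR cgamma Wi k) nz).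
case: n => [|n].
  exact: (derivable_block_mx (dP 0%N) (derivable_cst 0 z 1) (dQ 0%N) (derivable_cst 1%:M z 1)).
exact: (derivable_block_mx (dP n.+1)
  (derivable_mulmx (derivable_oppmx (dP n)) (derivable_cst (C n) z 1)) (dQ n.+1)
  (derivable_mulmx (derivable_oppmx (dQ n)) (derivable_cst (C n) z 1))).
Qed.

End DerivableY.

(* Matrix blocks have size N.+1, so all sizes >= 1 are covered. *)
Theorem proposition1 (R : realType) (N : nat) (gamma : R -> Cplx R)
    (W WL WR hL hR : Cplx R -> 'M[Cplx R]_N.+1)
    (PL PR : nat -> {poly 'M[Cplx R]_N.+1}) (C : nat -> 'M[Cplx R]_N.+1)
    (hgamma : loop_around_infinity gamma)
    (hbessel : bessel_type gamma W)
    (hreg : regular gamma W)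
    (hfact : bessel_factorization gamma W WL WR hL hR)
    (hP : biorthogonal gamma W PL PR C)
    (n : nat) (z : Cplx R) (hz : ~ loop_trace gamma z) :
  [/\ derivable (YL gamma W PL C n) z 1 /\ derivable (YR gamma W PR C n) z 1,
      ZL gamma W WL WR PL C n z \in unitmx /\
      ZR gamma W WL WR PR C n z \in unitmx,
      z ^+ 2 *: derive1 (YL gamma W PL C n) z
        + YL gamma W PL C n z *m block_mx (hL z) 0 0 (- hR z)
      = tML gamma W WL WR PL C n z *m YL gamma W PL C n z &
      z ^+ 2 *: derive1 (YR gamma W PR C n) z
        + block_mx (hR z) 0 0 (- hL z) *m YR gamma W PR C n z
      = YR gamma W PR C n z *m tMR gamma W WL WR PR C n z].
Proof.
have cgamma := loop_continuous_id hgamma.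
have Wi : mx_contour_integrable gamma W.
  (* Existence of the zeroth moment is integrability of [W] itself. *)
  move=> i j; have [/(_ 0%N i j) Wij _] := hreg.
  by apply: eq_contour_integrable Wij => w _; rewrite expr0 mul1r.
have [uYL uYR] := YL_YR_unit cgamma Wi hP n hz.
have dYL : derivable (YL gamma W PL C n) z 1 by exact: (derivable_YL cgamma Wi).
have dYR : derivable (YR gamma W PR C n) z 1 by exact: (derivable_YR cgamma Wi).
have [_ holo ode _] := hfact.
have [dWL dWR _ _] := holo z hz; have [eL eR] := ode z hz.
(* Differentiating the inverses of [WL] and [WR] takes invertibility on a neighbourhood of [z],
   which the openness of the complement of the loop provides. *)
have nz := off_loop_near cgamma hz.
have uWL : \forall x \near z, WL x \in unitmx.
  by apply: filterS nz => x /holo[].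
have uWR : \forall x \near z, WR x \in unitmx.
  by apply: filterS nz => x /holo[].
have [uZL EL] := structure_equation_left dYL dWL dWR uWL uWR uYL eL eR.
have [uZR ER] := structure_equation_right dYR dWL dWR uWL uWR uYR eL eR.
by split.
Qed.
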